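(* Let $r\in[0,1]$, let $\alpha:(a,b)\to\mathbb{R}$ be strictly increasing, let $\beta\in \mathrm{BV}_{\rm loc}((a,b),\mathbb{R})$, and assume $\theta_{1-r}(x)\neq0$ and $\theta_{r}(x)\neq0$ for all $x\in(a,b)$. If $u$ is a nontrivial (not identically zero) real-valued $r$-balanced solution of $-d(dy/d\alpha)+y\,d\beta=0$ on $(a,b)$, then the set $\mathcal{Z}_{(a,b)}(u)$ is a set of isolated points.
   Context: Throughout $-\infty\le a<b\le\infty$. $\mathrm{BV}_{\rm loc}((a,b),\mathbb{C})$ (resp. $\mathrm{BV}_{\rm loc}((a,b),\mathbb{R})$) is the space of complex-valued (resp. real-valued) functions of locally bounded variation on $(a,b)$. For such $f$: $f^-(x)=\lim_{t\uparrow x}f(t)$, $f^+(x)=\lim_{t\downarrow x}f(t)$; $df$ is the locally finite complex Borel measure on $(a,b)$ generated by $f$ (so $df([x,y))=f^-(y)-f^-(x)$ for $x<y$ in $(a,b)$); $\Delta_{df}(x)=df(\{x\})=f^+(x)-f^-(x)$. For $h$ locally integrable with respect to the total variation of $df$, $h\,df$ is the measure with density $h$ with respect to $df$. For $z\in\mathbb{C}$, $\theta_z(x)=1-z^2\Delta_{d\alpha}(x)\Delta_{d\beta}(x)$, $x\in(a,b)$. A function $f$ is $r$-balanced if $f\in \mathrm{BV}_{\rm loc}((a,b),\mathbb{C})$ and $f(x)=rf^-(x)+(1-r)f^+(x)$ for all $x\in(a,b)$. A function $u$ is an $r$-balanced solution of $-d(dy/d\alpha)+y\,d\beta=0$ on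 $(a,b)$ if $u$ is $r$-balanced, $du\ll d\alpha$ (locally), the Radon–Nikodym derivative $du/d\alpha$ is $r$-balanced (i.e. has an $r$-balanced representative, which is then unique because $\alpha$ is strictly increasing, and $du/d\alpha$ denotes that representative), and $-d(du/d\alpha)+u\,d\beta=0$ as measures. For $f\in \mathrm{BV}_{\rm loc}((a,b),\mathbb{R})$ and a subinterval $I\subset(a,b)$, $\mathcal{Z}_I(f)=\{x\in I: f^-(x)f^+(x)\le0\}$. *)

(* Defs.v *)
From HB Require Import structures.
From mathcomp Require Import all_boot all_order all_algebra.
From mathcomp Require Import all_classical all_reals all_analysis.
From mathcomp Require Import complex.

Set Implicit Arguments.
Unset Strict Implicit.
Unset Printing Implicit Defensive.

Import Order.TTheory GRing.Theory Num.Theory.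
Import numFieldNormedType.Exports.

Local Open Scope classical_set_scope.
Local Open Scope ring_scope.
Local Open Scope complex_scope.
Local Open Scope charge_scope.

Section balanced_solutions.
Context {R : realType}.
Implicit Types (a b : \bar R) (c d r x y : R).

Definition oitv a b : set R := [set x | (a < x%:E)%E /\ (x%:E < b)%E].

Definition left_lim {V : numFieldType} (f : R -> V) x : V :=
  lim (f t @[t --> x^'-]).

Definition right_lim {V : numFieldType} (f : R -> V) x : V :=
  lim (f t @[t --> x^'+]).

Definition jump (f : R -> R) x : R := right_lim f x - left_lim f x.

Definition BVloc a b (f : R -> R) : Prop :=
  forall c d, oitv a b c -> oitv a b d -> bounded_variation c d f.

Definition reF (f : R -> R[i]) : R -> R := fun x => complex.Re (f x).
Definition imF (f : R -> R[i]) : R -> R := fun x => complex.Im (f x).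

Definition BVlocC a b (f : R -> R[i]) : Prop :=
  BVloc a b (reF f) /\ BVloc a b (imF f).

Definition balanced a b r (f : R -> R[i]) : Prop :=
  BVlocC a b f /\
  forall x, oitv a b x ->
    f x = r%:C * left_lim f x + (1 - r)%:C * right_lim f x.

(* The measure df of f in BV_loc((a,b), R) is only locally finite, so it is
   represented by its restrictions to the open intervals ]c, d[ with
   a < c < d < b, which are finite; [generated_on c d f nu] says that nu is the
   restriction of df to ]c, d[, extended by 0 to the real line. Such a finite
   nu exists, and it is unique because the intervals [x, y[ with c < x < y < d
   form a pi-system generating the Borel subsets of ]c, d[; hence quantifying
   existentially over nu below amounts to naming df. *)
Definition generated_on c d (f : R -> R)
    (nu : set (measurableTypeR R) -> \bar R) : Prop :=
  (forall A, measurable A -> nu A = nu (A `&` `]c, d[%classic)) /\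
  (forall x y, c < x -> x < y -> y < d ->
     nu `[x, y[%classic = (left_lim f y - left_lim f x)%:E).

(* The integral against a signed measure does not depend on the choice of the
   Hahn decomposition. *)
Definition charge_integral (nu : {charge set (measurableTypeR R) -> \bar R})
    (A : set (measurableTypeR R)) (h : R -> R) : \bar R :=
  let: exist P exN := cid (Hahn_decomposition nu) in
  let: exist N nuPN := cid exN in
  (\int[jordan_pos nuPN]_(x in A) (h x)%:E
   - \int[jordan_neg nuPN]_(x in A) (h x)%:E)%E.

(* df << dalpha on ]c, d[, and v is a version of df/dalpha there. *)
Definition RN_derivative_on c d (alpha f v : R -> R) : Prop :=
  exists (mu : {finite_measure set (measurableTypeR R) -> \bar R})
         (nu : {charge set (measurableTypeR R) -> \bar R}),
    [/\ generated_on c d alpha mu,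
        generated_on c d f nu,
        nu `<< mu &
        {ae mu, forall x, `]c, d[%classic x -> ('d nu '/d mu) x = (v x)%:E}].

(* - df + h dbeta = 0 as measures on ]c, d[. *)
Definition measure_eq_on c d (beta h f : R -> R) : Prop :=
  exists mu nu : {charge set (measurableTypeR R) -> \bar R},
    [/\ generated_on c d beta mu,
        generated_on c d f nu &
        forall A, measurable A -> A `<=` `]c, d[%classic ->
          (- nu A + charge_integral mu A h = 0)%E].

(* v is du/dalpha. As dalpha and dbeta are real, the real and imaginary parts
   of the complex measures du, dv and u dbeta are d(Re u), d(Im u), d(Re v),
   d(Im v), (Re u) dbeta and (Im u) dbeta. *)
Definition balanced_solution a b r (alpha beta : R -> R) (u : R -> R[i]) :
    Prop :=
  balanced a b r u /\
  exists v : R -> R[i],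
    [/\ balanced a b r v,
        (forall c d, oitv a b c -> oitv a b d -> c < d ->
           RN_derivative_on c d alpha (reF u) (reF v) /\
           RN_derivative_on c d alpha (imF u) (imF v)) &
        (forall c d, oitv a b c -> oitv a b d -> c < d ->
           measure_eq_on c d beta (reF u) (reF v) /\
           measure_eq_on c d beta (imF u) (imF v))].

Definition theta (alpha beta : R -> R) (z : R[i]) x : R[i] :=
  1 - z ^+ 2 * (jump alpha x)%:C * (jump beta x)%:C.

Definition zero_set (I : set R) (f : R -> R) : set R :=
  [set x | I x /\ left_lim f x * right_lim f x <= 0].

End balanced_solutions.

(* Main.v *)
Require Import Defs.
From mathcomp Require Import all_boot all_order all_algebra.
From mathcomp Require Import all_classical all_reals all_analysis.
From mathcomp Require Import complex.
From mathcomp Require Import measurable_realfun ring lra.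

(* Let w be the r-balanced derivative du/dalpha and suppose zeros accumulate at
   x0, say from the right. Then u^+(x0) = 0. If w^+(x0) were nonzero, w would
   have constant sign on ]x0, x0 + e[, so that u, which is the integral of w
   against the strictly positive measure dalpha, could not vanish there. Hence
   u^+(x0) = w^+(x0) = 0. These data propagate:
   - to the right of x0: as du = w dalpha and dw = u dbeta, a common bound for
     |u| and |w| on ]x0, x0 + e[ can be halved indefinitely once dalpha and
     |dbeta| have mass less than 1/2 there;
   - across a point x: if u^-(x) = w^-(x) = 0, the jump relations give
     theta_{1-r}(x) u^+(x) = 0, and symmetrically with theta_r from the right.
   So u vanishes identically. *)

Set Implicit Arguments.
Unset Strict Implicit.
Unset Printing Implicit Defensive.

Import Order.TTheory GRing.Theory Num.Theory.
Import numFieldNormedType.Exports.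
Local Open Scope classical_set_scope.
Local Open Scope ring_scope.
Local Open Scope complex_scope.
Local Open Scope charge_scope.

(** * The equation in terms of one-sided limits *)

(** [fm] and [fp] stand for the left and right limits of one function, which itself does not appear:
    both tend to [fp x] from the right of [x] and to [fm x] from the left. *)
Definition regulated (R : realType) (c d : R) (fm fp : R -> R) : Prop :=
  forall x e, c < x < d -> 0 < e -> exists2 dl, 0 < dl &
    (forall y, x < y < x + dl -> `|fm y - fp x| < e /\ `|fp y - fp x| < e) /\
    (forall y, x - dl < y < x -> `|fm y - fm x| < e /\ `|fp y - fm x| < e).

(** [fm] tends to [fp y] from the right of [y], so a bound on [fm] there passes to [fp y]. *)
Lemma regulated_right_bound (R : realType) (c d : R) fm fp dl x y K :
  regulated c d fm fp ->
  c < x -> x < y < x + dl -> x + dl <= d ->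
  (forall z, x < z < x + dl -> `|fm z| <= K) -> `|fp y| <= K.
Proof.
move=> reg cx yI dld fmK; apply/ler_addgt0Pr => e e0.
have [|dy dy0 [right _]] := reg y e _ e0; first lra.
pose t := Num.min (y + dy) (x + dl).
have [t1 t2] : t <= y + dy /\ t <= x + dl by rewrite /t !ge_min !lexx orbT.
have yt : y < t by rewrite /t lt_min; apply/andP; split; lra.
pose z := (y + t) / 2; have zI : y < z < t by rewrite /z; lra.
have [|h _] := right z; first lra.
have zK : `|fm z| <= K by apply: fmK; lra.
rewrite -(subrK (fm z) (fp y)) (le_trans (ler_normD _ _))// distrC; lra.
Qed.

Lemma regulated_left_limit0 (R : realType) (c d : R) fm fp x y :
  regulated c d fm fp ->
  c < x -> x < y < d -> (forall z, x < z < y -> fm z = 0) -> fm y = 0.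
Proof.
move=> reg cx yI fm0; apply/eqP; rewrite -normr_le0; apply/ler_addgt0Pr => e e0.
have [|dy dy0 [_ left]] := reg y e _ e0; first lra.
pose t := Num.max (y - dy) x.
have [t1 t2] : y - dy <= t /\ x <= t by rewrite /t !le_max !lexx orbT.
have yt : t < y by rewrite /t gt_max; apply/andP; split; lra.
have [|] := left ((y + t) / 2); first lra.
rewrite fm0 ?sub0r ?normrN ?add0r => [h _|]; lra.
Qed.

(* An elementary shadow of the equation on ]c, d[: um, up, wm, wp are the
   one-sided limits of u and of w = du/dalpha, ja and jb the jumps of alpha and
   beta, m x y the dalpha-mass of ]x, y[ and n x y a bound for its |dbeta|-mass.
   The balanced functions themselves only occur as r * um + (1 - r) * up and
   r * wm + (1 - r) * wp. *)
Record balanced_system (R : realType) (c d r : R)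
    (um up wm wp ja jb : R -> R) (m n : R -> R -> R) : Prop := BalancedSystem {
  bs_weight : 0 <= r <= 1;
  bs_regu : regulated c d um up;
  bs_regw : regulated c d wm wp;
  bs_ja_ge0 : forall x, c < x < d -> 0 <= ja x;
  bs_jumpu : forall x, c < x < d ->
    up x - um x = (r * wm x + (1 - r) * wp x) * ja x;
  bs_jumpw : forall x, c < x < d ->
    wp x - wm x = (r * um x + (1 - r) * up x) * jb x;
  bs_theta1r : forall x, c < x < d -> 1 - (1 - r) ^+ 2 * ja x * jb x != 0;
  bs_thetar : forall x, c < x < d -> 1 - r ^+ 2 * ja x * jb x != 0;
  bs_m_gt0 : forall x y, c < x -> x < y -> y < d -> 0 < m x y;
  bs_incru : forall x y lo hi, c < x -> x < y -> y < d ->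
    (forall z, x < z < y -> lo <= r * wm z + (1 - r) * wp z <= hi) ->
    lo * m x y <= um y - up x <= hi * m x y;
  bs_incrw : forall x y K, c < x -> x < y -> y < d ->
    (forall z, x < z < y -> `|r * um z + (1 - r) * up z| <= K) ->
    `|wm y - wp x| <= K * n x y;
  bs_smallr : forall x e, c < x < d -> 0 < e -> exists2 dl, 0 < dl &
    forall y, x < y < x + dl -> y < d -> m x y < e /\ n x y < e;
  bs_smalll : forall x e, c < x < d -> 0 < e -> exists2 dl, 0 < dl &
    forall y, x - dl < y < x -> c < y -> m y x < e /\ n y x < e
}.

(* The substitution x |-> - x turns r into 1 - r and du/dalpha into its
   opposite. *)
Lemma balanced_system_reflect (R : realType) (c d r : R)
    (um up wm wp ja jb : R -> R) (m n : R -> R -> R) :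
  balanced_system c d r um up wm wp ja jb m n ->
  balanced_system (- d) (- c) (1 - r) (fun x => up (- x)) (fun x => um (- x))
    (fun x => - wp (- x)) (fun x => - wm (- x))
    (fun x => ja (- x)) (fun x => jb (- x))
    (fun x y => m (- y) (- x)) (fun x y => n (- y) (- x)).
Proof.
have opp_itv (x : R) : - d < x < - c -> c < - x < d by move=> ?; lra.
case=> r01 ru rw a0 ju jw t1 t2 m0 iu iw sr sl; split.
- lra.
- move=> x e /opp_itv xI e0; have [dl dl0 [right left]] := ru _ _ xI e0.
  exists dl => //; split=> y xy.
    by have [|] := left (- y); first lra.
  by have [|] := right (- y); first lra.
- move=> x e /opp_itv xI e0; have [dl dl0 [right left]] := rw _ _ xI e0.
  exists dl => //; split=> y xy; rewrite -!opprD !normrN.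
    by have [|] := left (- y); first lra.
  by have [|] := right (- y); first lra.
- by move=> x /opp_itv /a0.
- by move=> x /opp_itv /ju; lra.
- by move=> x /opp_itv /jw; lra.
- by move=> x /opp_itv /t2; have -> : 1 - (1 - r) = r by lra.
- by move=> x /opp_itv /t1.
- by move=> x y xd xy yc; apply: m0; lra.
- move=> x y lo hi xd xy yc H.
  have := iu (- y) (- x) (- hi) (- lo).
  move=> /(_ _ _ _ _)/andP[]; [lra..| |lra].
  move=> z zI; have := H (- z); rewrite opprK; lra.
- move=> x y K xd xy yc H.
  rewrite opprK addrC; apply: iw; [lra..|].
  move=> z zI; have {}H := H (- z); rewrite opprK in H.
  apply: le_trans (H _); last lra.
  have -> : 1 - (1 - r) = r by lra.
  by rewrite addrC.
- move=> x e /opp_itv xI e0; have [dl dl0 H] := sl _ _ xI e0.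
  by exists dl => // y yI yc; apply: H; lra.
- move=> x e /opp_itv xI e0; have [dl dl0 H] := sr _ _ xI e0.
  by exists dl => // y yI yc; apply: H; lra.
Qed.

(** * Propagation of zero data to the right *)

Section balanced_system_right.
Context (R : realType) (c d r : R) (um up wm wp ja jb : R -> R)
  (m n : R -> R -> R).
Context (bs : balanced_system c d r um up wm wp ja jb m n).

Local Notation vanish x := [/\ um x = 0, up x = 0, wm x = 0 & wp x = 0].

Lemma balanced_norm_le K p q : `|p| <= K -> `|q| <= K ->
  `|r * p + (1 - r) * q| <= K.
Proof.
move: (bs_weight bs) => /andP[r0 r1] pK qK.
rewrite (le_trans (ler_normD _ _))// !normrM (ger0_norm r0).
have r1' : 0 <= 1 - r by rewrite subr_ge0.
rewrite (ger0_norm r1').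
have := ler_wpM2l r0 pK; have := ler_wpM2l r1' qK; lra.
Qed.

(** If all four limits are at most [2 ^- k] in size after [x], the increments over []x, y[], which
    start from zero, are at most [2 ^- k] times a mass below 1/2; this improves the bound to
    [2 ^- k.+1]. *)
Lemma local_vanish x : c < x < d -> up x = 0 -> wp x = 0 ->
  exists2 dl, 0 < dl & x + dl <= d /\ forall y, x < y < x + dl -> vanish y.
Proof.
move=> xI upx wpx; have h0 : 0 < 2^-1 :> R by rewrite invr_gt0.
have [d1 d10 [rightu _]] := bs_regu bs xI h0.
have [d2 d20 [rightw _]] := bs_regw bs xI h0.
have [d3 d30 small] := bs_smallr bs xI h0.
pose dl := Num.min (Num.min d1 d2) (Num.min d3 (d - x)).
have [dl1 dl2 dl3 dl4] : [/\ dl <= d1, dl <= d2, dl <= d3 & dl <= d - x].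
  by rewrite /dl !ge_min !lexx ?orbT.
have dl0 : 0 < dl by rewrite /dl !lt_min d10 d20 d30/=; lra.
have bound k y : x < y < x + dl ->
    [/\ `|um y| <= 2 ^- k, `|up y| <= 2 ^- k, `|wm y| <= 2 ^- k &
        `|wp y| <= 2 ^- k].
  elim: k y => [|k IH] y yI.
    (* Base case: being within 1/2 of the zero right limits at [x] gives the bound 1. *)
    have [|ua ub] := rightu y; first lra.
    have [|wa wb] := rightw y; first lra.
    rewrite upx !subr0 in ua ub; rewrite wpx !subr0 in wa wb.
    by rewrite expr0 invr1; split; lra.
  have um_le z : x < z < x + dl -> `|um z| <= 2 ^- k.+1.
    move=> zI; have : - 2 ^- k * m x z <= um z - up x <= 2 ^- k * m x z.
      apply: (bs_incru bs); [lra..|move=> t tI; rewrite -ler_norml].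
      by have [|_ _ h1 h2] := IH t; [lra|exact: balanced_norm_le].
    rewrite upx subr0 => /andP[].
    have [||mz _] := small z; [lra..|].
    have : 0 < (2 : R) ^- k by rewrite invr_gt0 exprn_gt0.
    rewrite exprSr invfM ler_norml; nra.
  have wm_le z : x < z < x + dl -> `|wm z| <= 2 ^- k.+1.
    move=> zI; have : `|wm z - wp x| <= 2 ^- k * n x z.
      apply: (bs_incrw bs); [lra..|move=> t tI].
      by have [|h1 h2 _ _] := IH t; [lra|exact: balanced_norm_le].
    rewrite wpx subr0 => /le_trans; apply; rewrite exprSr invfM.
    have [||_ nz] := small z; [lra..|].
    by rewrite ler_wpM2l// ?ltW// invr_gt0 exprn_gt0.
  (* [bs_incru] and [bs_incrw] control the left limits; the right ones follow by passage to the
     limit. *)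
  split; [exact: um_le| |exact: wm_le|].
    by apply: regulated_right_bound (bs_regu bs) _ yI _ um_le; lra.
  by apply: regulated_right_bound (bs_regw bs) _ yI _ wm_le; lra.
have norm0 (z : R) : (forall k, `|z| <= 2 ^- k) -> z = 0.
  move=> zk; apply/eqP; apply: contraT; rewrite -normr_gt0 => z0.
  have [k _ /(_ k (leqnn k))] := near_infty_natSinv_expn_lt (PosNum z0).
  by rewrite /= div1r ltNge zk.
exists dl => //; split; first lra.
move=> y yI; split; apply: norm0 => k; by have [] := bound k y yI.
Qed.

(** The jump relations reduce to [up x = (1 - r) * wp x * ja x] and [wp x = (1 - r) * up x * jb x];
    eliminating [wp x] leaves the nonzero theta factor times [up x]. *)
Lemma vanish_cross x : c < x < d -> um x = 0 -> wm x = 0 -> vanish x.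
Proof.
move=> xI umx wmx; have := bs_jumpu bs xI; have := bs_jumpw bs xI.
rewrite umx wmx !subr0 !mulr0 !add0r => jw ju.
have upx : up x = 0.
  apply/eqP; have /negPf := bs_theta1r bs xI.
  move: ju; rewrite jw => ju th.
  have : (1 - (1 - r) ^+ 2 * ja x * jb x) * up x = 0.
    by rewrite mulrBl mul1r {1}ju; ring.
  by move=> /eqP; rewrite mulf_eq0 th.
by split=> //; rewrite jw upx mulr0 mul0r.
Qed.

(** Real induction on the set [T] of points up to which everything vanishes: [sup T] inherits the
    vanishing by left limits and [vanish_cross], and [local_vanish] would lead beyond [sup T] if it
    were below [y]. *)
Lemma right_vanish x : c < x < d -> up x = 0 -> wp x = 0 ->
  forall y, x < y < d -> vanish y.
Proof.
move=> xI upx wpx y yI.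
pose T := [set z | x <= z <= y /\ forall t, x < t <= z -> vanish t].
have Tx : T x by split=> [|t]; [|move=> ?; exfalso]; lra.
have hasT : has_sup T by split; [exists x|exists y => z [/andP[]]].
have xs : x <= sup T by apply: ub_le_sup => //; have [] := hasT.
have sy : sup T <= y by apply: sup_le_ub; [exists x|move=> z [/andP[]]].
have below t : x < t < sup T -> vanish t.
  move=> /andP[xt ts]; have [|z [_ Tz] tz] := @sup_gt _ T _ _ ts.
    by exists x.
  by apply: Tz; lra.
have at_sup : x < sup T -> vanish (sup T).
  move=> xs'; apply: vanish_cross; first lra.
    apply: (@regulated_left_limit0 _ c d um up x) (bs_regu bs) _ _ _; [lra..|].
    by move=> z /below [].
  apply: (@regulated_left_limit0 _ c d wm wp x) (bs_regw bs) _ _ _; [lra..|].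
  by move=> z /below [].
(* If [sup T] is [x], the right limits vanish by hypothesis, and they are all that [local_vanish]
   requires. *)
have [us ws] : up (sup T) = 0 /\ wp (sup T) = 0.
  have [<-//|nxs] := eqVneq x (sup T).
  by have [|] := at_sup; first by rewrite lt_neqAle nxs.
have upto t : x < t <= sup T -> vanish t.
  rewrite le_eqVlt => /andP[xt /predU1P[ts|ts]]; last by apply: below; lra.
  by rewrite ts; apply: at_sup; rewrite -ts.
have [sTy|nsy] := eqVneq (sup T) y.
  by apply: upto; lra.
have {nsy sy} sy : sup T < y by rewrite lt_neqAle nsy.
have [|dl dl0 [dld loc]] := local_vanish _ us ws; first lra.
(* [local_vanish] covers an open interval, hence half of [dl]; the cap at [y] keeps [z] eligible for
   [T]. *)
pose z := Num.min (sup T + dl / 2) y.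
have [z1 z2] : z <= sup T + dl / 2 /\ z <= y by rewrite /z !ge_min !lexx orbT.
have sz : sup T < z by rewrite /z lt_min; apply/andP; split; lra.
suff Tz : T z.
  have := ub_le_sup (proj2 hasT) Tz; lra.
split; first lra.
move=> t tI; have [ts|ts] := leP t (sup T); first by apply: upto; lra.
by apply: loc; lra.
Qed.
End balanced_system_right.

(** * Isolated zeros or identical vanishing *)

Section balanced_system_zeros.
Context (R : realType).
Implicit Types (c d r : R) (um up wm wp ja jb : R -> R) (m n : R -> R -> R).

(** In the reflected system the left limits at [- x] are [up x] and [- wp x], so [vanish_cross]
    there, which rests on [bs_thetar], yields zero left limits at [x]. Then [right_vanish] applies
    to the system and to its reflection. *)
Lemma balanced_system_eq0 c d r um up wm wp ja jb m n x :
  balanced_system c d r um up wm wp ja jb m n ->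
  c < x < d -> up x = 0 -> wp x = 0 ->
  forall y, c < y < d -> um y = 0 /\ up y = 0.
Proof.
move=> bs xI upx wpx y yI; have bs' := balanced_system_reflect bs.
have NxI : - d < - x < - c by lra.
have [umx _ wmx _] : [/\ um x = 0, up x = 0, wm x = 0 & wp x = 0].
  have := vanish_cross bs' NxI; rewrite opprK => /(_ upx).
  rewrite wpx oppr0 => /(_ erefl)[_ um0 _ wm0]; split=> //.
  by rewrite -(opprK (wm x)) wm0 oppr0.
have [yx|xy|->//] := ltgtP y x; last first.
  by have [|um0 up0 _ _] := right_vanish bs xI upx wpx (y := y); first lra.
have := right_vanish bs' NxI; rewrite opprK wmx oppr0.
move=> /(_ umx erefl (- y)) [|]; first lra.
by rewrite opprK.
Qed.

(** If [up x] is nonzero, both limits of u keep its sign just after [x]. If [up x] vanishes but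
    [wp x] does not, u leaves zero with the sign of [wp x], as [m x y] is positive; the jump of u at
    [y] has that sign or is zero, so [up y] and [um y] agree in sign. *)
Lemma zeros_right c d r um up wm wp ja jb m n x :
  balanced_system c d r um up wm wp ja jb m n -> c < x < d ->
  (exists2 dl, 0 < dl & forall y, x < y < x + dl -> 0 < um y * up y) \/
  (forall y, c < y < d -> um y = 0 /\ up y = 0).
Proof.
move=> bs xI.
have [up0|upx] := eqVneq (up x) 0; last first.
  left; have ux0 : 0 < `|up x| by rewrite normr_gt0.
  have [dl dl0 [right _]] := bs_regu bs xI ux0.
  exists dl => // y /right[].
  have [u0|u0|/eqP] := ltgtP (up x) 0; last by rewrite (negPf upx).
    by rewrite (ltr0_norm u0) !ltr_norml => h1 h2; rewrite nmulr_rgt0; lra.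
  by rewrite (gtr0_norm u0) !ltr_norml => h1 h2; rewrite mulr_gt0//; lra.
have [wp0|wpx] := eqVneq (wp x) 0.
  by right; exact: balanced_system_eq0 bs xI up0 wp0.
(* Values within this distance of [wp x] have its sign and stay away from zero. *)
left; have w20 : 0 < `|wp x| / 2 by rewrite divr_gt0 ?normr_gt0.
have [dl dl0 [right _]] := bs_regw bs xI w20.
have r01 := bs_weight bs.
exists (Num.min dl (d - x)); first by rewrite lt_min dl0/=; lra.
move=> y /andP[xy]; rewrite -ltrBlDl lt_min => /andP[ydl yd].
have yI : c < y < d by lra.
have := bs_jumpu bs yI; have := bs_ja_ge0 bs yI.
have m0 : 0 < m x y by apply: (bs_m_gt0 bs); lra.
move=> a0.
(* The endpoint [y] is included: interior values govern the increment over []x, y[], the value at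
   [y] governs the jump there. *)
have near_w z : x < z <= y ->
    `|r * wm z + (1 - r) * wp z - wp x| <= `|wp x| / 2.
  move=> zI; have [|h1 h2] := right z; first lra.
  have -> : r * wm z + (1 - r) * wp z - wp x =
    r * (wm z - wp x) + (1 - r) * (wp z - wp x) by ring.
  by apply: (balanced_norm_le bs); exact: ltW.
have := near_w y; rewrite ler_distl => /(_ _)/andP[]; first lra.
have : (wp x - `|wp x| / 2) * m x y <= um y - up x <=
       (wp x + `|wp x| / 2) * m x y.
  apply: (bs_incru bs); [lra..|move=> z zI].
  by rewrite -ler_distl; apply: near_w; lra.
rewrite up0 subr0; set w := r * wm y + (1 - r) * wp y.
move=> /andP[um1 um2] w1 w2 ju.
have [u0|u0|/eqP] := ltgtP (wp x) 0; last by rewrite (negPf wpx).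
  rewrite (ltr0_norm u0) in um1 um2 w1 w2.
  have um0 : um y < 0 by have := nmulr_rlt0 (m x y) u0; rewrite m0; lra.
  have wa0 : w * ja y <= 0 by rewrite nmulr_rle0//; lra.
  by rewrite nmulr_rgt0//; lra.
rewrite (gtr0_norm u0) in um1 um2 w1 w2.
have um0 : 0 < um y by have := mulr_gt0 u0 m0; lra.
have wa0 : 0 <= w * ja y by rewrite mulr_ge0//; lra.
by rewrite mulr_gt0//; lra.
Qed.

(** Reflection exchanges [um] and [up] and so preserves their product; [zeros_right] for the
    reflected system therefore treats the left side of [x]. *)
Lemma balanced_system_isolated_zeros c d r um up wm wp ja jb m n x :
  balanced_system c d r um up wm wp ja jb m n -> c < x < d ->
  (exists2 dl, 0 < dl &
     forall y, y != x -> `|x - y| < dl -> 0 < um y * up y) \/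
  (forall y, c < y < d -> um y = 0 /\ up y = 0).
Proof.
move=> bs xI; have NxI : - d < - x < - c by lra.
have [[d1 d10 right]|] := zeros_right bs xI; last by right.
have [[d2 d20 left]|z0] := zeros_right (balanced_system_reflect bs) NxI.
  left; exists (Num.min d1 d2); first by rewrite lt_min d10.
  move=> y yx; rewrite lt_min !ltr_norml => yI.
  have [xy|xy|xy] := ltgtP x y.
  - by apply: right; lra.
  - by have := left (- y); rewrite opprK mulrC; apply; lra.
  - by rewrite xy eqxx in yx.
right=> y yI; have := z0 (- y); rewrite opprK => h.
by have [|] := h; first lra.
Qed.

End balanced_system_zeros.

(** * One-sided limits *)

Section one_sided_limits.
Context (R : realType).
Implicit Types (c d x y : R) (f : R -> R).

Lemma near_right_itv x (P : set R) : (\forall y \near x^'+, P y) ->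
  exists2 dl, 0 < dl & forall y, x < y < x + dl -> P y.
Proof.
move=> [dl /= dl0 H]; exists dl => // y /andP[xy yd]; apply: H => //=.
by rewrite ltr_norml; lra.
Qed.

Lemma near_left_itv x (P : set R) : (\forall y \near x^'-, P y) ->
  exists2 dl, 0 < dl & forall y, x - dl < y < x -> P y.
Proof.
move=> [dl /= dl0 H]; exists dl => // y /andP[xy yd]; apply: H => //=.
by rewrite ltr_norml; lra.
Qed.

Definition one_sided_limits c d f :=
  forall x, c < x < d -> cvg (f t @[t --> x^'-]) /\ cvg (f t @[t --> x^'+]).

Lemma nondecreasing_one_sided_limits c d f :
  {in `]c, d[ &, {homo f : x y / x <= y}} -> one_sided_limits c d f.
Proof.
move=> ndf x /[dup] xI /andP[cx xd]; split.
- apply: nondecreasing_at_left_is_cvgr.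
    apply: filterS (nbhs_left_gt cx) => y cy s t; rewrite !in_itv/= => sI tI.
    by apply: ndf; rewrite in_itv/=; lra.
  apply: filterS (nbhs_left_gt cx) => y cy; exists (f x) => _ /= [t tI <-].
  by rewrite in_itv/= in tI; apply: ndf; rewrite ?in_itv/=; lra.
- apply: nondecreasing_at_right_is_cvgr.
    apply: filterS (nbhs_right_lt xd) => y cy s t; rewrite !in_itv/= => sI tI.
    by apply: ndf; rewrite in_itv/=; lra.
  apply: filterS (nbhs_right_lt xd) => y cy; exists (f x) => _ /= [t tI <-].
  by rewrite in_itv/= in tI; apply: ndf; rewrite ?in_itv/=; lra.
Qed.

Lemma nondecreasing_itv_measurable c d f :
  {in `]c, d[ &, {homo f : x y / x <= y}} -> measurable_fun `]c, d[ f.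
Proof.
move=> ndf; apply: (measurability (@RGenCInfty.G R)) => [|/= _ [_] [r] -> <-].
  exact: RGenCInfty.measurableE.
apply: is_interval_measurable => s t/=.
rewrite !in_itv/= !andbT => -[sI fs] [tI ft] u
  /andP[su ut]; have uI' : c < u < d by lra.
split; rewrite ?in_itv//= andbT (le_trans fs)// ndf ?in_itv//=; lra.
Qed.

Lemma bounded_variation_nondecreasing_diff c d f : bounded_variation c d f ->
  exists g h, [/\ {in `]c, d[ &, {homo g : x y / x <= y}},
    {in `]c, d[ &, {homo h : x y / x <= y}} & {in `]c, d[, f =1 g \- h}].
Proof.
move=> BVf.
(* The positive variation of [f] is the negative variation of [\- f], so one monotonicity result
   serves for both parts. *)
have BVNf : bounded_variation c d (\- f) by exact/bounded_variationN.
exists (fine \o pos_tv c f), (fine \o neg_tv c f); split.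
- move=> x y xI yI; apply: (fine_neg_tv_nondecreasing BVNf);
    exact: subset_itv_oo_cc.
- move=> x y xI yI; apply: (fine_neg_tv_nondecreasing BVf);
    exact: subset_itv_oo_cc.
- move=> x xI; apply: (bounded_variation_pos_neg_tvE BVf).
  exact: subset_itv_oo_cc.
Qed.

Lemma bounded_variation_one_sided_limits c d f :
  bounded_variation c d f -> one_sided_limits c d f.
Proof.
move=> /bounded_variation_nondecreasing_diff[g [h [ndg ndh fE]]].
move=> x /[dup] xI /andP[cx xd].
have [gl gr] := nondecreasing_one_sided_limits ndg xI.
have [hl hr] := nondecreasing_one_sided_limits ndh xI.
(* [f] agrees with [g \- h] inside []c, d[], which suffices along a filter that eventually stays
   there. *)
have near_eq (F : set_system R) : ProperFilter F ->
    (\forall t \near F, t \in `]c, d[) ->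
    cvg ((g \- h) t @[t --> F]) -> cvg (f t @[t --> F]).
  move=> FF FI /cvg_ex[l ghl]; apply/cvg_ex; exists l.
  apply: cvg_trans ghl; apply: near_eq_cvg.
  by apply: filterS FI => t /fE.
split; apply: near_eq (is_cvgB _ _) => //.
- apply: filterS2 (nbhs_left_gt cx) (nbhs_left_lt x) => t ct tx.
  by rewrite in_itv/=; lra.
- apply: filterS2 (nbhs_right_gt x) (nbhs_right_lt xd) => t xt td.
  by rewrite in_itv/=; lra.
Qed.

Lemma bounded_variation_measurable c d f :
  bounded_variation c d f -> measurable_fun `]c, d[ f.
Proof.
move=> /bounded_variation_nondecreasing_diff[g [h [ndg ndh fE]]].
apply: (eq_measurable_fun (g \- h)) => [x|].
  by rewrite inE/= => /fE.
by apply: measurable_funB; exact: nondecreasing_itv_measurable.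
Qed.

Lemma left_lim_near c d f x e : one_sided_limits c d f -> c < x < d -> 0 < e ->
  exists2 dl, 0 < dl &
    forall y, x - dl < y < x -> `|f y - left_lim f x| < e.
Proof.
move=> lf /lf[cvl _] e0; apply: near_left_itv.
by move/cvgrPdistC_lt: cvl; apply.
Qed.

Lemma right_lim_near c d f x e : one_sided_limits c d f -> c < x < d ->
  0 < e -> exists2 dl, 0 < dl &
    forall y, x < y < x + dl -> `|f y - right_lim f x| < e.
Proof.
move=> lf /lf[_ cvr] e0; apply: near_right_itv.
by move/cvgrPdistC_lt: cvr; apply.
Qed.

(** If [f] is within [e / 2] of [l] on an interval adjacent to [y], the limit of [f] at [y] from
    that side is within [e] of [l], by comparison at a single point [t]. In the four cases [l] is a
    one-sided limit at [x]. *)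
Lemma one_sided_limits_regulated c d f :
  one_sided_limits c d f -> regulated c d (left_lim f) (right_lim f).
Proof.
move=> lf x e xI e0; have e20 : 0 < e / 2 by lra.
have near_l y l z : c < y < d -> z < y ->
    (forall t, z < t < y -> `|f t - l| < e / 2) -> `|left_lim f y - l| < e.
  move=> yI zy ftl; have [dy dy0 h] := left_lim_near lf yI e20.
  pose t := (y + Num.max (y - dy) z) / 2.
  have [t1 t2] : y - dy <= Num.max (y - dy) z /\ z <= Num.max (y - dy) z.
    by rewrite !le_max !lexx orbT.
  have t3 : Num.max (y - dy) z < y by rewrite gt_max zy andbT; lra.
  have {}h : `|f t - left_lim f y| < e / 2 by apply: h; rewrite /t; lra.
  have {}ftl : `|f t - l| < e / 2 by apply: ftl; rewrite /t; lra.
  by move: h ftl; rewrite !ltr_norml; lra.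
have near_r y l z : c < y < d -> y < z ->
    (forall t, y < t < z -> `|f t - l| < e / 2) -> `|right_lim f y - l| < e.
  move=> yI zy ftl; have [dy dy0 h] := right_lim_near lf yI e20.
  pose t := (y + Num.min (y + dy) z) / 2.
  have [t1 t2] : Num.min (y + dy) z <= y + dy /\ Num.min (y + dy) z <= z.
    by rewrite !ge_min !lexx orbT.
  have t3 : y < Num.min (y + dy) z by rewrite lt_min zy andbT; lra.
  have {}h : `|f t - right_lim f y| < e / 2 by apply: h; rewrite /t; lra.
  have {}ftl : `|f t - l| < e / 2 by apply: ftl; rewrite /t; lra.
  by move: h ftl; rewrite !ltr_norml; lra.
have [d1 d10 right] := right_lim_near lf xI e20.
have [d2 d20 left] := left_lim_near lf xI e20.
pose dl := Num.min (Num.min d1 d2) (Num.min (x - c) (d - x)).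
have [dl1 dl2 dl3 dl4] : [/\ dl <= d1, dl <= d2, dl <= x - c & dl <= d - x].
  by rewrite /dl !ge_min !lexx ?orbT.
exists dl; first by rewrite /dl !lt_min d10 d20/=; lra.
split=> y yI; split.
- by apply: (near_l _ _ x) => [||t tI]; [lra..|apply: right; lra].
- by apply: (near_r _ _ (x + dl)) => [||t tI]; [lra..|apply: right; lra].
- by apply: (near_l _ _ (x - dl)) => [||t tI]; [lra..|apply: left; lra].
- by apply: (near_r _ _ x) => [||t tI]; [lra..|apply: left; lra].
Qed.
End one_sided_limits.

(** * Measures of small intervals and integral bounds *)

Section finite_measure_bounds.
Context d (T : measurableType d) (R : realType).
Implicit Types (mu : {finite_measure set T -> \bar R})
  (nu : {charge set T -> \bar R}) (A D : set T) (v h : T -> R) (lo hi K : R).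

(** The bounds hold for the Radon-Nikodym derivative off a null set [N], and are integrated over [A]
    minus [N]. On a singleton [lo = hi] makes this exact; on open intervals it bounds increments. *)
Lemma RN_derivative_bound mu nu v D A lo hi : nu `<< mu ->
  {ae mu, forall x, D x -> ('d nu '/d mu) x = (v x)%:E} ->
  measurable A -> A `<=` D ->
  (forall x, A x -> lo <= v x <= hi) ->
  lo * fine (mu A) <= fine (nu A) <= hi * fine (mu A).
Proof.
move=> numu [N [mN muN0 vN]] mA AD vA.
have mAN : measurable (A `\` N) by exact: measurableD.
have muAN : mu (A `\` N) = mu A.
  have -> : mu (A `\` N) = (mu A - mu (A `&` N))%E.
    by apply: measureD => //; rewrite ltey_eq fin_num_measure.
  rewrite (_ : mu (A `&` N) = 0%E) ?sube0//.
  apply/eqP; rewrite eq_le measure_ge0 andbT -muN0.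
  by apply: le_measure; rewrite ?inE//; exact: measurableI.
have intA : mu.-integrable A ('d nu '/d mu).
  by apply: (integrableS measurableT) => //; exact: Radon_Nikodym_integrable.
have nuA : nu A = (\int[mu]_(x in A `\` N) ('d nu '/d mu) x)%E.
  rewrite (Radon_Nikodym_integral numu mA).
  by apply: negligible_integral.
have intAN : mu.-integrable (A `\` N) ('d nu '/d mu).
  by apply: integrableS intA => //; exact: subDsetl.
have intc k : mu.-integrable (A `\` N) (cst k%:E).
  apply: finite_measure_integrable_cst => //.
have cstE k : (\int[mu]_(x in A `\` N) (cst k%:E) x)%E = (k * fine (mu A))%:E.
  by rewrite EFinM fineK ?fin_num_measure// -muAN integral_cst.
have vAN x : x \in A `\` N -> (lo%:E <= ('d nu '/d mu) x <= hi%:E)%E.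
  rewrite inE => -[Ax Nx]; have -> : ('d nu '/d mu) x = (v x)%:E.
    by apply: contrapT => nv; apply: Nx; apply: vN => /= /(_ (AD _ Ax)).
  by rewrite !lee_fin; exact: vA.
rewrite -!lee_fin fineK ?fin_num_measure// -!cstE nuA.
by apply/andP; split; apply: le_integral => // x /vAN /andP[].
Qed.


Lemma finite_measure_integral_bound mu h A K : measurable A ->
  measurable_fun A h -> (forall x, A x -> `|h x| <= K) ->
  (`|\int[mu]_(x in A) (h x)%:E| <= K%:E * mu A)%E.
Proof.
move=> mA mh hK; rewrite -integral_cst//.
apply: (le_trans (le_abse_integral _ mA _)); first exact/measurable_EFinP.
apply: ge0_le_integral => //.
by apply: measurableT_comp => //; exact/measurable_EFinP.
Qed.

Lemma integral_singleton mu h (x : T) : measurable [set x] ->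
  (\int[mu]_(t in [set x]) (h t)%:E = (h x)%:E * mu [set x])%E.
Proof.
move=> mx; rewrite -integral_cst//; apply: eq_integral => t.
by rewrite inE => ->.
Qed.

End finite_measure_bounds.

Section measures.
Context (R : realType).
Local Notation M :=
  ({finite_measure set (measurableTypeR R) -> \bar R})%type.
Local Notation Ch := ({charge set (measurableTypeR R) -> \bar R})%type.
Implicit Types (c d x y : R) (f h v : R -> R).

(** The intervals []x, x + 1/(n+1)[] exclude [x] and decrease to the empty set, so continuity from
    above applies even if [mu] has an atom at [x]. *)
Lemma finite_measure_small_right (mu : M) x e : 0 < e ->
  exists2 dl, 0 < dl &
    forall y, x < y < x + dl -> fine (mu `]x, y[%classic) < e.
Proof.
move=> e0; pose F n : set (measurableTypeR R) := `]x, x + n.+1%:R^-1[%classic.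
have F0 : \bigcap_n F n = set0.
  apply/seteqP; split=> // y Fy /=.
  have xy : 0 < y - x by have := Fy 0%N I; rewrite /F /= in_itv/=; lra.
  have [k _ /(_ k (leqnn k)) /= ky] := near_infty_natSinv_lt (PosNum xy).
  have := Fy k I; rewrite /F /= in_itv/=; move: ky; set z := _^-1; lra.
have mF n : measurable (F n) by exact: measurable_itv.
have : mu \o F @ \oo --> mu (\bigcap_n F n).
  apply: nonincreasing_cvg_mu => //.
  - by rewrite ltey_eq fin_num_measure.
  - by rewrite F0; exact: measurable0.
  - move=> n k nk; apply/subsetPset => y.
    rewrite /F /= !in_itv/= => /andP[-> /=].
    by move=> /lt_le_trans; apply; rewrite lerD2l lef_pV2 ?posrE// ler_nat.
rewrite F0 measure0 => /fine_cvgP[_ /cvgrPdistC_lt /(_ _ e0)[k _]].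
move=> /(_ k (leqnn k)) /=.
rewrite subr0 => kE.
exists k.+1%:R^-1; first by rewrite invr_gt0.
move=> y yI; apply: le_lt_trans (le_lt_trans (ler_norm _) kE).
apply: fine_le; rewrite ?fin_num_measure//=.
apply: le_measure; rewrite ?inE//.
by move=> t; rewrite /F /= !in_itv/=; move: yI; set z := _^-1; lra.
Qed.

Lemma finite_measure_small_left (mu : M) x e : 0 < e ->
  exists2 dl, 0 < dl &
    forall y, x - dl < y < x -> fine (mu `]y, x[%classic) < e.
Proof.
move=> e0; pose F n : set (measurableTypeR R) := `]x - n.+1%:R^-1, x[%classic.
have F0 : \bigcap_n F n = set0.
  apply/seteqP; split=> // y Fy /=.
  have xy : 0 < x - y by have := Fy 0%N I; rewrite /F /= in_itv/=; lra.
  have [k _ /(_ k (leqnn k)) /= ky] := near_infty_natSinv_lt (PosNum xy).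
  have := Fy k I; rewrite /F /= in_itv/=; move: ky; set z := _^-1; lra.
have mF n : measurable (F n) by exact: measurable_itv.
have : mu \o F @ \oo --> mu (\bigcap_n F n).
  apply: nonincreasing_cvg_mu => //.
  - by rewrite ltey_eq fin_num_measure.
  - by rewrite F0; exact: measurable0.
  - move=> n k nk; apply/subsetPset => y.
    rewrite /F /= !in_itv/= => /andP[+ ->].
    rewrite andbT; apply: le_lt_trans.
    by rewrite lerD2l lerN2 lef_pV2 ?posrE// ler_nat.
rewrite F0 measure0 => /fine_cvgP[_ /cvgrPdistC_lt /(_ _ e0)[k _]].
move=> /(_ k (leqnn k)) /=.
rewrite subr0 => kE.
exists k.+1%:R^-1; first by rewrite invr_gt0.
move=> y yI; apply: le_lt_trans (le_lt_trans (ler_norm _) kE).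
apply: fine_le; rewrite ?fin_num_measure//=.
apply: le_measure; rewrite ?inE//.
by move=> t; rewrite /F /= !in_itv/=; move: yI; set z := _^-1; lra.
Qed.


(** [m1] and [m2] are the Jordan parts for the Hahn decomposition chosen in [charge_integral]; their
    sum, the total variation of [nu], later provides the [n] of [balanced_system]. *)
Lemma charge_integral_bound (nu : Ch) h : exists m1 m2 : M,
  (forall A, measurable A ->
    `|fine (nu A)| <= fine (m1 A) + fine (m2 A)) /\
  (forall A K, measurable A -> measurable_fun A h ->
    (forall x, A x -> `|h x| <= K) ->
    `|fine (charge_integral nu A h)| <= K * (fine (m1 A) + fine (m2 A))).
Proof.
rewrite /charge_integral; case: cid => P exN; case: cid => N nuPN.
exists (jordan_pos nuPN), (jordan_neg nuPN); split=> [A mA|A K mA mh hK].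
  rewrite (jordan_decomp nuPN mA) /cadd/= cscaleN1 fineB ?fin_num_measure//.
  rewrite (le_trans (ler_normB _ _))//.
  by rewrite !ger0_norm ?fine_ge0.
(* Finiteness is proved along with the bound because splitting [fine] over a difference requires
   it. *)
have bound (m : M) :
    (\int[m]_(x in A) (h x)%:E)%E \is a fin_num /\
    `|fine (\int[m]_(x in A) (h x)%:E)%E| <= K * fine (m A).
  have := finite_measure_integral_bound m mA mh hK.
  have mfin : m A \is a fin_num by rewrite fin_num_measure.
  rewrite -[m A]fineK// -EFinM => le_int.
  have int_fin : (\int[m]_(x in A) (h x)%:E)%E \is a fin_num.
    by rewrite fin_num_abs (le_lt_trans le_int)// ltry.
  by split=> //; rewrite -lee_fin; move: le_int; rewrite -{1}(fineK int_fin).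
have [fp le_p] := bound (jordan_pos nuPN).
have [fn le_n] := bound (jordan_neg nuPN).
by rewrite fineB// (le_trans (ler_normB _ _))// mulrDr lerD.
Qed.

Lemma charge_integral_singleton (nu : Ch) h x :
  charge_integral nu [set x] h = ((h x)%:E * nu [set x])%E.
Proof.
rewrite /charge_integral; case: cid => P exN; case: cid => N nuPN.
have mx : measurable ([set x] : set (measurableTypeR R)).
  exact: measurable_set1.
rewrite !integral_singleton// (jordan_decomp nuPN mx) /cadd/= cscaleN1.
by rewrite muleBr// fin_num_adde_defr// fin_num_measure.
Qed.

End measures.

(** * Generated measures of points and open intervals *)

Section generated.
Context (R : realType).
Local Notation M :=
  ({finite_measure set (measurableTypeR R) -> \bar R})%type.
Local Notation Ch := ({charge set (measurableTypeR R) -> \bar R})%type.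
Implicit Types (c d x y : R) (f h v : R -> R).

Lemma charge_itvco (nu : Ch) x y : x < y ->
  nu `[x, y[%classic = (nu [set x] + nu `]x, y[%classic)%E.
Proof.
move=> xy; rewrite -(@setU1itv _ _ _ _ false)?bnd_simp//.
have mx : measurable ([set x] : set (measurableTypeR R)).
  exact: measurable_set1.
have mxy : measurable (`]x, y[%classic : set (measurableTypeR R)).
  exact: measurable_itv.
rewrite chargeU//.
by apply/seteqP; split=> // t [/= ->]; rewrite /= in_itv/= ltxx.
Qed.

(** As [y] decreases to [x] in the formula for [[x, y[], the mass of []x, y[] tends to zero and
    [left_lim f y] tends to [right_lim f x]. *)
Lemma generated_on_singleton c d f (nu : Ch) x : one_sided_limits c d f ->
  generated_on c d f nu -> c < x < d -> nu [set x] = (jump f x)%:E.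
Proof.
move=> lf [_ nuE] xI.
have mx : measurable ([set x] : set (measurableTypeR R)).
  exact: measurable_set1.
rewrite -[nu [set x]]fineK ?fin_num_measure//; congr EFin.
apply/eqP; rewrite -subr_eq0 -normr_le0; apply/ler_addgt0Pr => e e0.
(* One third for each Jordan part on []x, y[], one for the distance from [left_lim f y] to
   [right_lim f x]. *)
have e30 : 0 < e / 3 by lra.
have [m1 [m2 [nu_le _]]] := charge_integral_bound nu f.
have [d1 d10 small1] := finite_measure_small_right m1 x e30.
have [d2 d20 small2] := finite_measure_small_right m2 x e30.
have [d3 d30 [near_x _]] := one_sided_limits_regulated lf xI e30.
pose dl := Num.min (Num.min d1 d2) (Num.min d3 (d - x)).
have [dl1 dl2 dl3 dl4] : [/\ dl <= d1, dl <= d2, dl <= d3 & dl <= d - x].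
  by rewrite /dl !ge_min !lexx ?orbT.
have dl0 : 0 < dl by rewrite /dl !lt_min d10 d20 d30/=; lra.
pose y := x + dl / 2; have yI : x < y < x + dl by rewrite /y; lra.
have {}small1 := small1 y; have {}small2 := small2 y.
have [|near_y _] := near_x y; first lra.
have mxy : measurable (`]x, y[%classic : set (measurableTypeR R)).
  exact: measurable_itv.
have {}nu_le := nu_le _ mxy.
have : nu `[x, y[%classic = (left_lim f y - left_lim f x)%:E by apply: nuE; lra.
rewrite charge_itvco; last lra.
rewrite -[nu [set x]]fineK ?fin_num_measure//.
rewrite -[nu `]x, y[%classic]fineK ?fin_num_measure// => -[].
move: near_y nu_le; rewrite /jump ltr_norml !ler_norml.
lra.
Qed.

Lemma generated_on_itvoo c d f (nu : Ch) x y : one_sided_limits c d f ->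
  generated_on c d f nu -> c < x -> x < y -> y < d ->
  nu `]x, y[%classic = (left_lim f y - right_lim f x)%:E.
Proof.
move=> lf gf cx xy yd; have := proj2 gf x y cx xy yd.
rewrite charge_itvco// (generated_on_singleton lf gf); last lra.
have mxy : measurable (`]x, y[%classic : set (measurableTypeR R)).
  exact: measurable_itv.
rewrite -[nu `]x, y[%classic]fineK ?fin_num_measure// /jump => -[] ?.
by congr EFin; lra.
Qed.

End generated.

(** * From balanced solutions to the elementary system *)

Section complex_limits.
Context (R : realType).
Implicit Types (c d r x : R) (f : R -> R[i]).

Lemma cvg_complex (F : set_system R) (FF : ProperFilter F) f (p q : R) :
  reF f @ F --> p -> imF f @ F --> q ->
  (f : R -> (R[i] : numFieldType)) @ F --> (p +i* q : (R[i] : numFieldType)).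
Proof.
move=> fp fq; apply/cvgrPdistC_lt => e e0.
(* A positive element of [R[i]] has zero imaginary part. *)
have [e1 e10 eE] : exists2 e1 : R, 0 < e1 & e = e1%:C.
  by case: e e0 => e1 e2; rewrite ltcE/= => /andP[/eqP -> e10]; exists e1.
have e20 : 0 < e1 / 2 by lra.
move/cvgrPdistC_lt : fp => /(_ _ e20) fp.
move/cvgrPdistC_lt : fq => /(_ _ e20) fq.
apply: filterS2 fp fq => t pt qt; rewrite eE.
have -> : f t - p +i* q = (reF f t - p)%:C + 'i * (imF f t - q)%:C.
  by rewrite /reF /imF; case: (f t) => a b /=; simpc.
rewrite (le_lt_trans (ler_normD _ _))// normrM.
have normR (y : R) : `|y%:C| = `|y|%:C.
  by rewrite normc_def/= expr0n/= addr0 sqrtr_sqr.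
have -> : `|'i : R[i]| = 1 by rewrite normc_def/= expr0n/= add0r expr1n sqrtr1.
by rewrite mul1r !normR -rmorphD ltcR; lra.
Qed.

Lemma lim_complex (F : set_system R) (FF : ProperFilter F) f :
  cvg (reF f @ F) -> cvg (imF f @ F) ->
  lim ((f : R -> (R[i] : numFieldType)) @ F) =
  lim (reF f @ F) +i* lim (imF f @ F) :> (R[i] : numFieldType).
Proof. by move=> fp fq; apply/cvg_lim => //; exact: cvg_complex. Qed.

Lemma BVloc_one_sided_limits (a b : \bar R) c d (g : R -> R) : BVloc a b g ->
  oitv a b c -> oitv a b d -> one_sided_limits c d g.
Proof.
by move=> BVg ac bd; apply: bounded_variation_one_sided_limits; exact: BVg.
Qed.

Lemma balanced_Re (a b : \bar R) c d r f x : balanced a b r f ->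
  oitv a b c -> oitv a b d -> c < x < d -> oitv a b x ->
  reF f x = r * left_lim (reF f) x + (1 - r) * right_lim (reF f) x.
Proof.
move=> [[BVre BVim] fE] ac bd xI xab.
have [rel rer] := BVloc_one_sided_limits BVre ac bd xI.
have [iml imr] := BVloc_one_sided_limits BVim ac bd xI.
rewrite {1}/reF fE// /left_lim /right_lim !lim_complex//=.
by rewrite !mul0r !subr0.
Qed.

Lemma theta_neq0 (alpha beta : R -> R) z x : theta alpha beta z%:C x != 0 ->
  1 - z ^+ 2 * jump alpha x * jump beta x != 0.
Proof.
apply: contra => /eqP th0; rewrite /theta -rmorphXn -!rmorphM.
by rewrite -(rmorph1 (real_complex R)) -rmorphB th0.
Qed.

(** Serves to enclose a zero of u and a point where u is nonzero in one bounded interval with ends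
    inside [(a, b)]. *)
Lemma oitv_nbhs (a b : \bar R) x y : oitv a b x -> oitv a b y -> x <= y ->
  exists c d, [/\ oitv a b c, oitv a b d, c < x & y < d].
Proof.
move=> [ax xb] [ay yb] xy.
have [c ac cx] : exists2 c, (a < c%:E)%E & c < x.
  case: a ax {ay} => [a| |] //; last by exists (x - 1); rewrite ?ltNyr//; lra.
  by rewrite lte_fin => ax; exists ((a + x) / 2); rewrite ?lte_fin; lra.
have [d yd db] : exists2 d, y < d & (d%:E < b)%E.
  case: b yb {xb} => [b| |] //; last by exists (y + 1); rewrite ?ltry//; lra.
  by rewrite lte_fin => yb; exists ((b + y) / 2); rewrite ?lte_fin; lra.
exists c, d; split=> //; split=> //.
  by apply: lt_trans xb; rewrite lte_fin.
by apply: lt_trans ay _; rewrite lte_fin.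
Qed.

End complex_limits.

(** * The system attached to a balanced solution *)

Section solution_system.
Context (R : realType).
Implicit Types (alpha beta u : R -> R).

(** Two intermediate points [s < t] separate the limits: the right limit at [x] is at most
    [alpha s], the left limit at [y] at least [alpha t]. *)
Lemma increasing_gap_gt0 c d alpha x y :
  (forall s t, c < s < d -> c < t < d -> s < t -> alpha s < alpha t) ->
  c < x -> x < y -> y < d -> right_lim alpha x < left_lim alpha y.
Proof.
move=> inc cx xy yd.
have lf : one_sided_limits c d alpha.
  apply: nondecreasing_one_sided_limits => s t; rewrite !in_itv/= => sI tI.
  by rewrite le_eqVlt => /predU1P[->//|st]; apply/ltW/inc.
have [_ cvx] : _ /\ _ := lf x ltac:(lra).
have [cvy _] : _ /\ _ := lf y ltac:(lra).
pose s := (2 * x + y) / 3; pose t := (x + 2 * y) / 3.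
have [xs st ty] : [/\ x < s, s < t & t < y] by rewrite /s /t; split; lra.
apply: le_lt_trans (lt_le_trans (inc s t _ _ st) _); [|lra|lra|].
  apply: limr_le => //; apply: filterS2 (nbhs_right_gt x) (nbhs_right_lt xs).
  by move=> z xz zs; apply/ltW/inc; lra.
apply: limr_ge => //; apply: filterS2 (nbhs_left_gt ty) (nbhs_left_lt y).
by move=> z tz zy; apply/ltW/inc; lra.
Qed.

(** [w] is the real part of the derivative, [m] the dalpha-mass and [n] the total variation of dbeta
    on open intervals. The identity for [u x] lets vanishing limits force [u x = 0]. *)
Lemma balanced_solution_system (a b : \bar R) r alpha beta u c d :
  0 <= r <= 1 ->
  (forall x y, oitv a b x -> oitv a b y -> x < y -> alpha x < alpha y) ->
  BVloc a b beta ->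
  (forall x, oitv a b x -> theta alpha beta (1 - r)%:C x != 0) ->
  (forall x, oitv a b x -> theta alpha beta r%:C x != 0) ->
  balanced_solution a b r alpha beta (fun x => (u x)%:C) ->
  oitv a b c -> oitv a b d -> c < d ->
  exists w m n, balanced_system c d r (left_lim u) (right_lim u)
    (left_lim w) (right_lim w) (jump alpha) (jump beta) m n /\
    forall x, c < x < d -> u x = r * left_lim u x + (1 - r) * right_lim u x.
Proof.
move=> r01 inc BVbeta th1 th2 [bal_u [v [bal_v der eqn]]] ac bd cd.
have Iab x : c < x < d -> oitv a b x.
  move=> /andP[cx xd]; split.
    by apply: lt_trans (proj1 ac) _; rewrite lte_fin.
  by apply: lt_trans (proj2 bd); rewrite lte_fin.
have inc' s t : c < s < d -> c < t < d -> s < t -> alpha s < alpha t.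
  by move=> sI tI; apply: inc; exact: Iab.
have lalpha : one_sided_limits c d alpha.
  apply: nondecreasing_one_sided_limits => s t; rewrite !in_itv/= => sI tI.
  by rewrite le_eqVlt => /predU1P[->//|st]; apply/ltW/inc'.
have lbeta : one_sided_limits c d beta by exact: BVloc_one_sided_limits ac bd.
have BVu : BVloc a b u := proj1 (proj1 bal_u).
have lu : one_sided_limits c d u by exact: BVloc_one_sided_limits ac bd.
pose w := reF v.
have lw : one_sided_limits c d w.
  by apply: BVloc_one_sided_limits ac bd; exact: (proj1 (proj1 bal_v)).
have uE x : c < x < d -> u x = r * left_lim u x + (1 - r) * right_lim u x.
  by move=> xI; exact: (balanced_Re bal_u ac bd xI (Iab _ xI)).
have wE x : c < x < d -> w x = r * left_lim w x + (1 - r) * right_lim w x.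
  by move=> xI; exact: (balanced_Re bal_v ac bd xI (Iab _ xI)).
have meas_u : measurable_fun `]c, d[ u.
  by apply: bounded_variation_measurable; exact: BVu.
have [[mu [nu [gmu gnu numu nuE]]] _] := der c d ac bd cd.
have [[mb [nw [gmb gnw nwE]]] _] := eqn c d ac bd cd.
(* The same measure viewed as a charge, the form that [generated_on_singleton] and
   [generated_on_itvoo] accept. *)
have gmu' : generated_on c d alpha (charge_of_finite_measure mu) by [].
have {}nwE A : measurable A -> A `<=` `]c, d[%classic ->
    nw A = charge_integral mb A u.
  (* As [nw A] is finite, the equation rules out an infinite integral and can be solved for
     [nw A]. *)
  move=> mA Acd; have := nwE A mA Acd.
  rewrite -[nw A]fineK ?fin_num_measure//.
  case: charge_integral => [z| |] // -[] /eqP.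
  by rewrite addrC subr_eq0 => /eqP ->.
have [m1 [m2 [_ ci_le]]] := charge_integral_bound mb u.
have mset x : measurable ([set x] : set (measurableTypeR R)).
  exact: measurable_set1.
have mitv x y : measurable (`]x, y[%classic : set (measurableTypeR R)).
  exact: measurable_itv.
have subx x : c < x < d -> [set x] `<=` `]c, d[%classic.
  by move=> xI _ ->; rewrite /= in_itv.
have subxy x y : c < x -> y < d -> `]x, y[%classic `<=` `]c, d[%classic.
  by move=> cx yd z; rewrite /= !in_itv/=; lra.
have mux x : c < x < d -> mu [set x] = (jump alpha x)%:E.
  exact: generated_on_singleton lalpha gmu'.
have muxy x y : c < x -> x < y -> y < d ->
    mu `]x, y[%classic = (left_lim alpha y - right_lim alpha x)%:E.
  exact: generated_on_itvoo lalpha gmu'.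
exists w, (fun x y => fine (mu `]x, y[%classic)),
  (fun x y => fine (m1 `]x, y[%classic) + fine (m2 `]x, y[%classic)).
split=> //; split=> //.
- exact: one_sided_limits_regulated.
- exact: one_sided_limits_regulated.
- by move=> x xI; rewrite -lee_fin -mux.
- move=> x xI; rewrite -wE//.
  (* Equal lower and upper bounds [w x] on the singleton give the jump of [u] exactly. *)
  have := RN_derivative_bound numu nuE (mset x) (subx x xI)
    (lo := w x) (hi := w x).
  rewrite (generated_on_singleton lu gnu)// mux//= /jump => H.
  apply/eqP; rewrite eq_le andbC; apply: H.
  by move=> _ ->; rewrite lexx.
- move=> x xI; rewrite -uE//.
  have := nwE _ (mset x) (subx x xI); rewrite charge_integral_singleton.
  rewrite (generated_on_singleton lw gnw)//.
  rewrite (generated_on_singleton lbeta gmb)//.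
  by rewrite -EFinM => -[].
- by move=> x xI; apply: theta_neq0; exact/th1/Iab.
- by move=> x xI; apply: theta_neq0; exact/th2/Iab.
- move=> x y cx xy yd; rewrite muxy//= subr_gt0.
  exact: increasing_gap_gt0 inc' cx xy yd.
- move=> x y lo hi cx xy yd H.
  have := RN_derivative_bound numu nuE (mitv x y) (subxy x y cx yd)
    (lo := lo) (hi := hi).
  rewrite (generated_on_itvoo lu gnu)//=; apply=> z; rewrite /= in_itv/= => zI.
  by rewrite -/w wE; [exact: H|lra].
- move=> x y K cx xy yd H.
  have := ci_le _ K (mitv x y).
  rewrite -nwE ?(generated_on_itvoo lw gnw)//=; last exact: subxy.
  apply.
    by apply: measurable_funS meas_u => //; exact: subxy.
  by move=> z; rewrite /= in_itv/= => zI; rewrite uE; [exact: H|lra].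
- move=> x e xI e0; have e20 : 0 < e / 2 by lra.
  have [d1 d10 H1] := finite_measure_small_right mu x e0.
  have [d2 d20 H2] := finite_measure_small_right m1 x e20.
  have [d3 d30 H3] := finite_measure_small_right m2 x e20.
  exists (Num.min d1 (Num.min d2 d3)); first by rewrite !lt_min d10 d20.
  move=> y /andP[xy]; rewrite -ltrBlDl !lt_min => /and3P[y1 y2 y3] _.
  have h1 := H1 y ltac:(lra); have h2 := H2 y ltac:(lra).
  by have h3 := H3 y ltac:(lra); lra.
- move=> x e xI e0; have e20 : 0 < e / 2 by lra.
  have [d1 d10 H1] := finite_measure_small_left mu x e0.
  have [d2 d20 H2] := finite_measure_small_left m1 x e20.
  have [d3 d30 H3] := finite_measure_small_left m2 x e20.
  exists (Num.min d1 (Num.min d2 d3)); first by rewrite !lt_min d10 d20.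
  move=> y /andP[+ yx]; rewrite ltrBlDl -ltrBlDr !lt_min => /and3P[y1 y2 y3] _.
  have h1 := H1 y ltac:(lra); have h2 := H2 y ltac:(lra).
  by have h3 := H3 y ltac:(lra); lra.
Qed.

End solution_system.

Theorem theorem4p5 (R : realType) (a b : \bar R) (r : R)
    (alpha beta u : R -> R) :
  (a < b)%E ->
  0 <= r <= 1 ->
  (forall x y, oitv a b x -> oitv a b y -> x < y -> alpha x < alpha y) ->
  BVloc a b beta ->
  (forall x, oitv a b x -> theta alpha beta (1 - r)%:C x != 0) ->
  (forall x, oitv a b x -> theta alpha beta r%:C x != 0) ->
  balanced_solution a b r alpha beta (fun x => (u x)%:C) ->
  (exists x, oitv a b x /\ u x != 0) ->
  forall x, zero_set (oitv a b) u x -> isolated (zero_set (oitv a b) u) x.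
Proof.
move=> _ r01 inc BVbeta th1 th2 sol [y [yab uy]] x Zx; have [xab _] := Zx.
(* The dichotomy yields vanishing on []c, d[], so this interval must contain both [x] and the point
   [y] where [u] is nonzero. *)
have [c [d [ac bd xI yI]]] : exists c d,
    [/\ oitv a b c, oitv a b d, c < x < d & c < y < d].
  have [xy|/ltW yx] := leP x y.
    have [c [d [ac bd cx yd]]] := oitv_nbhs xab yab xy.
    by exists c, d; split=> //; lra.
  have [c [d [ac bd cx yd]]] := oitv_nbhs yab xab yx.
  by exists c, d; split=> //; lra.
have cd : c < d by lra.
have [w [m [n [bs uE]]]] :=
  balanced_solution_system r01 inc BVbeta th1 th2 sol ac bd cd.
have [[dl dl0 gt0]|u0] := balanced_system_isolated_zeros bs xI; last first.
  by have [l0 r0] := u0 y yI; rewrite uE// l0 r0 !mulr0 addr0 eqxx in uy.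
split; first by rewrite inE.
exists (ball x dl); first exact: nbhsx_ballx.
apply/seteqP; split=> [z [/= zx [_ zle]]|_ ->]; last first.
  by split=> //; exact: ballxx.
by apply: contrapT => /eqP nzx; have := gt0 z nzx zx; rewrite ltNge zle.
Qed.
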